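(* The prop $\mathbf{Rel}$ of relations between finite sets is isomorphic, as a prop, to the prop for special bicommutative bimonoids.
   Context: A prop is a symmetric strict monoidal category whose objects are the natural numbers and whose tensor product on objects is addition; a morphism of props is an identity-on-objects symmetric strict monoidal functor. $\mathbf{Rel}$ is the prop equivalent to the category of finite sets and binary relations with monoidal product disjoint union: a morphism $n\to m$ is a binary relation from $\{1,\dots,n\}$ to $\{1,\dots,m\}$, composition is composition of relations, and the monoidal product is disjoint union. A signature $\Sigma$ is a set of formal generators $\sigma\colon n\to m$ ($n,m\in\mathbb N$). $\Sigma$-terms are built inductively from the empty term $\varnothing\colon 0\to0$ (the identity on $0$), $\mathrm{id}\colon1\to1$, the braiding $s\colon2\to2$, and the generators, using composition $\circ$ and monoidal sum $+$. The free prop $F\Sigma$ (the value at $\Sigma$ of the left adjoint of the underlying-signature functor $\mathbf{PROP}\to\mathbf{Set}^{\mathbb N\times\mathbb N}$) has as morphisms the $\Sigma$-terms, modulo the axioms of symmetric strict monoidal categories. A symmetric monoidal theory $(\Sigma,E)$ is a signature together with a set $E$ of equations, i.e. pairs of $\Sigma$-terms of the same type. Regarding $E$ also as a signature, the prop for $(\Sigma,E)$ is the coequalizer in the category of props of the two maps $\lambda,\rho\colon FE\rightrightarrows F\Sigma$ sending each equation to its first, respectively second, term. The theory of special bicommutative bimonoids has generators $\mu\colon2\to1$, $\eta\colon0\to1$, $\delta\colon1\to2$, $\epsilon\colon1\to0$ and equations - commutative monoid: $\mu\circ(\mu+\mathrm{id})=\mu\circ(\mathrm{id}+\mu)$, $\mu\circ(\eta+\mathrm{id})=\mathrm{id}$,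 $\mu\circ s=\mu$; - cocommutative comonoid: $(\delta+\mathrm{id})\circ\delta=(\mathrm{id}+\delta)\circ\delta$, $(\epsilon+\mathrm{id})\circ\delta=\mathrm{id}$, $s\circ\delta=\delta$; - bimonoid laws: $(\mu+\mu)\circ(\mathrm{id}+s+\mathrm{id})\circ(\delta+\delta)=\delta\circ\mu$, $\epsilon\circ\mu=\epsilon+\epsilon$, $\delta\circ\eta=\eta+\eta$; - extra law: $\epsilon\circ\eta=\varnothing$; - special law: $\mu\circ\delta=\mathrm{id}$. *)

(* Defs.v *)
From mathcomp Require Import all_boot.
From mathcomp Require Import generic_quotient boolp.

Set Implicit Arguments.
Unset Strict Implicit.
Unset Printing Implicit Defensive.

(* Transport along equalities of source and target.  Strict associativity and
   unitality relate morphisms whose types are only propositionally equal. *)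
Definition hcast (H : nat -> nat -> Type) n n' m m'
    (en : n = n') (em : m = m') (f : H n m) : H n' m' :=
  eq_rect m (H n') (eq_rect n (fun k => H k m) f n' en) m' em.

Record smc_ops := SmcOps {
  hom : nat -> nat -> Type;
  idm : forall n, hom n n;
  comp : forall n m p, hom m p -> hom n m -> hom n p;
  tens : forall n m p q, hom n m -> hom p q -> hom (n + p) (m + q);
  braid : forall n m, hom (n + m) (m + n) }.

Arguments idm {D} n : rename.
Arguments comp {D n m p} g f : rename.
Arguments tens {D n m p q} f g : rename.
Arguments braid {D} n m : rename.

Declare Scope smc_scope.
Delimit Scope smc_scope with smc.
Notation "g ∘ f" := (comp g f) (at level 40, left associativity) : smc_scope.
Notation "f ⊕ g" := (tens f g) (at level 50, left associativity) : smc_scope.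
Local Open Scope quotient_scope.
Local Open Scope smc_scope.

(* The axioms of symmetric strict monoidal categories, as pairs of parallel
   morphisms which have to be identified.  In [smc_tens1l] the types agree
   because [0 + n] computes to [n].  The second hexagon and the unit laws of
   the braiding follow from [smc_braidK] and [smc_hexagon]. *)
Inductive smc_axiom (D : smc_ops) : forall n m, hom D n m -> hom D n m -> Prop :=
| smc_compA n m p q (h : hom D p q) (g : hom D m p) (f : hom D n m) :
    smc_axiom (h ∘ (g ∘ f)) ((h ∘ g) ∘ f)
| smc_comp1l n m (f : hom D n m) : smc_axiom (idm m ∘ f) f
| smc_comp1r n m (f : hom D n m) : smc_axiom (f ∘ idm n) f
| smc_tens1 n m : smc_axiom (idm n ⊕ idm m) (idm (n + m))
| smc_tensM n m p n' m' p' (g : hom D m p) (f : hom D n m)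
      (g' : hom D m' p') (f' : hom D n' m') :
    smc_axiom ((g ⊕ g') ∘ (f ⊕ f')) ((g ∘ f) ⊕ (g' ∘ f'))
| smc_tensA n m p q r s (f : hom D n m) (g : hom D p q) (h : hom D r s) :
    smc_axiom (hcast (addnA n p r) (addnA m q s) (f ⊕ (g ⊕ h))) ((f ⊕ g) ⊕ h)
| smc_tens1l n m (f : hom D n m) : smc_axiom (idm 0 ⊕ f : hom D n m) f
| smc_tens1r n m (f : hom D n m) :
    smc_axiom (hcast (addn0 n) (addn0 m) (f ⊕ idm 0)) f
| smc_braid_nat n m p q (f : hom D n m) (g : hom D p q) :
    smc_axiom (braid m q ∘ (f ⊕ g)) ((g ⊕ f) ∘ braid n p)
| smc_braidK n m : smc_axiom (braid m n ∘ braid n m) (idm (n + m))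
| smc_hexagon n m p :
    smc_axiom (braid n (m + p))
      (hcast erefl (addnA m p n) (idm m ⊕ braid n p)
       ∘ hcast (esym (addnA n m p)) (esym (addnA m n p)) (braid n m ⊕ idm p)).

Record PROP := Prop_of_ops {
  prop_ops :> smc_ops;
  smc_law : forall n m (f g : hom prop_ops n m), smc_axiom f g -> f = g }.

Record prop_hom (P Q : smc_ops) := PropHom {
  hom_map :> forall n m, hom P n m -> hom Q n m;
  hom_mapI : forall n, hom_map (idm n) = idm n;
  hom_mapC : forall n m p (g : hom P m p) (f : hom P n m),
    hom_map (g ∘ f) = hom_map g ∘ hom_map f;
  hom_mapT : forall n m p q (f : hom P n m) (g : hom P p q),
    hom_map (f ⊕ g) = hom_map f ⊕ hom_map g;
  hom_mapB : forall n m, hom_map (braid n m) = braid n m }.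

Arguments hom_map {P Q} h n m f : rename.

Definition prop_iso (P Q : PROP) : Prop :=
  exists (F : prop_hom P Q) (G : prop_hom Q P),
    (forall n m (f : hom P n m), G _ _ (F _ _ f) = f) /\
    (forall n m (g : hom Q n m), F _ _ (G _ _ g) = g).

Section Quotient.

Context (T : Type) (R : T -> T -> Prop) (eR : RelationClasses.Equivalence R).

Definition quot_brel (x y : {classic T}) : bool := `[< R x y >].

Fact quot_brel_refl : reflexive quot_brel.
Proof. by move=> x; apply/asboolP; case: eR => r _ _; apply: r. Qed.

Fact quot_brel_sym : symmetric quot_brel.
Proof.
by case: eR => _ s _ x y; apply/asboolP/asboolP => h; apply: s.
Qed.

Fact quot_brel_trans : transitive quot_brel.
Proof.
case: eR => _ _ t y x z /asboolP h1 /asboolP h2; apply/asboolP.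
exact: t h1 h2.
Qed.

Definition quot_equiv :=
  EquivRel quot_brel quot_brel_refl quot_brel_sym quot_brel_trans.

Definition quot : Type := {eq_quot quot_equiv}.

Definition qpi (x : T) : quot := \pi_({eq_quot quot_equiv}) (x : {classic T}).
Definition qrepr (x : quot) : T := repr (x : {eq_quot quot_equiv}).

Lemma qreprK x : qpi (qrepr x) = x.
Proof. exact: reprK. Qed.

Lemma qpiP x y : qpi x = qpi y <-> R x y.
Proof.
split; first by move/eqquotP => /asboolP.
by move=> h; apply/eqquotP/asboolP.
Qed.

Lemma qrepr_piP x : R (qrepr (qpi x)) x.
Proof. by apply/qpiP; rewrite qreprK. Qed.

End Quotient.

Inductive cong (D : smc_ops) (B : forall n m, hom D n m -> hom D n m -> Prop) :
  forall n m, hom D n m -> hom D n m -> Prop :=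
| cong_base n m (f g : hom D n m) : B n m f g -> cong B f g
| cong_refl n m (f : hom D n m) : cong B f f
| cong_sym n m (f g : hom D n m) : cong B f g -> cong B g f
| cong_trans n m (f g h : hom D n m) : cong B f g -> cong B g h -> cong B f h
| cong_comp n m p (g g' : hom D m p) (f f' : hom D n m) :
    cong B g g' -> cong B f f' -> cong B (g ∘ f) (g' ∘ f')
| cong_tens n m p q (f f' : hom D n m) (g g' : hom D p q) :
    cong B f f' -> cong B g g' -> cong B (f ⊕ g) (f' ⊕ g').

Section QuotientProp.

Context (D : smc_ops) (B : forall n m, hom D n m -> hom D n m -> Prop).

Fact cong_equiv n m : RelationClasses.Equivalence (@cong D B n m).
Proof.
split; [exact: cong_refl | exact: cong_sym | exact: cong_trans].
Qed.

Definition qhom n m := quot (cong_equiv n m).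
Definition qclass n m (f : hom D n m) : qhom n m := qpi (cong_equiv n m) f.

Definition quot_ops : smc_ops := {|
  hom := qhom;
  idm := fun n => qclass (idm n);
  comp := fun n m p (g : qhom m p) (f : qhom n m) => qclass (qrepr g ∘ qrepr f);
  tens := fun n m p q (f : qhom n m) (g : qhom p q) => qclass (qrepr f ⊕ qrepr g);
  braid := fun n m => qclass (braid n m) |}.

Lemma qclassP n m (f g : hom D n m) : qclass f = qclass g <-> cong B f g.
Proof. exact: qpiP. Qed.

Lemma qclass_surj n m (x : hom quot_ops n m) : exists f, x = qclass f.
Proof. by exists (qrepr x); rewrite /qclass qreprK. Qed.

Lemma qclassC n m p (g : hom D m p) (f : hom D n m) :
  qclass (g ∘ f) = (qclass g : hom quot_ops m p) ∘ (qclass f : hom quot_ops n m).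
Proof.
by apply/qclassP/cong_comp; apply: cong_sym; apply: qrepr_piP.
Qed.

Lemma qclassT n m p q (f : hom D n m) (g : hom D p q) :
  qclass (f ⊕ g) = (qclass f : hom quot_ops n m) ⊕ (qclass g : hom quot_ops p q).
Proof.
by apply/qclassP/cong_tens; apply: cong_sym; apply: qrepr_piP.
Qed.

Definition quot_pi : prop_hom D quot_ops :=
  @PropHom D quot_ops qclass (fun=> erefl) qclassC qclassT (fun _ _ => erefl).

Lemma qclass_cast n n' m m' (en : n = n') (em : m = m') (f : hom D n m) :
  hcast en em (qclass f : hom quot_ops n m) = qclass (hcast en em f).
Proof. by case: n' / en; case: m' / em. Qed.

Context (B_law : forall n m (f g : hom D n m), smc_axiom f g -> cong B f g).

Lemma quot_law n m (f g : hom quot_ops n m) : smc_axiom f g -> f = g.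
Proof.
case: n m f g / => >;
  repeat match goal with f : hom quot_ops _ _ |- _ =>
    case: (qclass_surj f) => {f}[? ->] end;
  rewrite ?[idm _]/(qclass _) ?[braid _ _]/(qclass _);
  rewrite -?(qclassC, qclassT, qclass_cast) -?(qclassC, qclassT);
  rewrite ?qclass_cast -?(qclassC, qclassT) ?qclass_cast;
  apply/qclassP/B_law; by constructor.
Qed.

Definition quot_prop : PROP := Prop_of_ops quot_law.

End QuotientProp.

Inductive coeq_rel (A P : smc_ops) (F G : prop_hom A P) :
  forall n m, hom P n m -> hom P n m -> Prop :=
| CoeqRel n m (a : hom A n m) : coeq_rel F G (F n m a) (G n m a).

Lemma coeq_law (A P : PROP) (F G : prop_hom A P) n m (f g : hom P n m) :
  smc_axiom f g -> cong (coeq_rel F G) f g.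
Proof. by move=> /smc_law ->; apply: cong_refl. Qed.

Definition coeq (A P : PROP) (F G : prop_hom A P) : PROP :=
  quot_prop (@coeq_law A P F G).

Definition coeq_pi (A P : PROP) (F G : prop_hom A P) : prop_hom P (coeq F G) :=
  quot_pi (coeq_rel F G).

Lemma cong_sound (D Q : smc_ops) (B : forall n m, hom D n m -> hom D n m -> Prop)
    (H : prop_hom D Q) :
  (forall n m (f g : hom D n m), B n m f g -> H n m f = H n m g) ->
  forall n m (f g : hom D n m), cong B f g -> H n m f = H n m g.
Proof.
move=> hB n m f g; elim=> {n m f g} //.
- by move=> > _ -> _ ->.
- by move=> > _ + _; rewrite !hom_mapC => -> ->.
- by move=> > _ + _; rewrite !hom_mapT => -> ->.
Qed.

Section QuotientLift.

Context (D Q : smc_ops) (B : forall n m, hom D n m -> hom D n m -> Prop).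
Context (H : prop_hom D Q).
Context (HB : forall n m (f g : hom D n m), B f g -> H n m f = H n m g).

Definition quot_lift_map n m (x : hom (quot_ops B) n m) : hom Q n m :=
  H n m (qrepr x).

Lemma quot_lift_mapE n m (f : hom D n m) :
  quot_lift_map (qclass B f) = H n m f.
Proof. by apply: (cong_sound HB); apply: qrepr_piP. Qed.

Fact quot_lift_mapI n : quot_lift_map (idm n) = idm n.
Proof. by rewrite quot_lift_mapE hom_mapI. Qed.

Fact quot_lift_mapC n m p (g : hom (quot_ops B) m p) (f : hom (quot_ops B) n m) :
  quot_lift_map (g ∘ f) = quot_lift_map g ∘ quot_lift_map f.
Proof. by rewrite quot_lift_mapE hom_mapC. Qed.

Fact quot_lift_mapT n m p q
    (f : hom (quot_ops B) n m) (g : hom (quot_ops B) p q) :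
  quot_lift_map (f ⊕ g) = quot_lift_map f ⊕ quot_lift_map g.
Proof. by rewrite quot_lift_mapE hom_mapT. Qed.

Fact quot_lift_mapB n m : quot_lift_map (braid n m) = braid n m.
Proof. by rewrite quot_lift_mapE hom_mapB. Qed.

Definition quot_lift : prop_hom (quot_ops B) Q :=
  PropHom quot_lift_mapI quot_lift_mapC quot_lift_mapT quot_lift_mapB.

End QuotientLift.

(* [coeq F G] is the coequalizer of [F] and [G] in the category of props. *)
Theorem coeq_universal (A P : PROP) (F G : prop_hom A P) :
  (forall n m (a : hom A n m), coeq_pi F G n m (F n m a) = coeq_pi F G n m (G n m a))
  /\ forall (Q : PROP) (H : prop_hom P Q),
    (forall n m (a : hom A n m), H n m (F n m a) = H n m (G n m a)) ->
    (exists K : prop_hom (coeq F G) Q,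
      forall n m (f : hom P n m), K n m (coeq_pi F G n m f) = H n m f)
    /\ forall K K' : prop_hom (coeq F G) Q,
      (forall n m (f : hom P n m),
        K n m (coeq_pi F G n m f) = K' n m (coeq_pi F G n m f)) ->
      forall n m (x : hom (coeq F G) n m), K n m x = K' n m x.
Proof.
split=> [n m a|Q H hH].
  by apply/qclassP/cong_base; constructor.
split; last by move=> K K' h n m x; case: (qclass_surj x) => f ->; apply: h.
have hF n m (f g : hom P n m) : coeq_rel F G f g -> H n m f = H n m g.
  by case=> n1 m1 a; apply: hH.
by exists (quot_lift hF) => n m f; apply: quot_lift_mapE.
Qed.

Definition signature := nat -> nat -> Type.

Inductive term (S : signature) : nat -> nat -> Type :=
| TEmpty : term S 0 0
| TId : term S 1 1
| TBraid : term S 2 2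
| TGen n m : S n m -> term S n m
| TComp n m p : term S m p -> term S n m -> term S n p
| TSum n m p q : term S n m -> term S p q -> term S (n + p) (m + q).

Arguments TEmpty {S}.
Arguments TId {S}.
Arguments TBraid {S}.

(* The identity of [n], the braiding of [1] with [m] and the braiding of [n]
   with [m], as terms over the identity of [1] and the braiding [2 -> 2]. *)
Fixpoint tid (S : signature) n : term S n n :=
  if n is k.+1 then TSum TId (tid S k) else TEmpty.

Fixpoint tbraid1 (S : signature) m : term S (1 + m) (m + 1) :=
  if m is k.+1 then
    (TComp (TSum TId (tbraid1 S k) : term S (1 + (1 + k)) (k.+1 + 1))
           (TSum TBraid (tid S k) : term S (1 + k.+1) (1 + (1 + k))))
  else TId.

Fixpoint tbraid (S : signature) n m : term S (n + m) (m + n) :=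
  if n is k.+1 then
    hcast erefl (esym (addnA m 1 k))
      (TComp (TSum (tbraid1 S m) (tid S k))
             (TSum TId (tbraid S k m) : term S (k.+1 + m) (1 + m + k)))
  else hcast erefl (esym (addn0 m)) (tid S m).

Definition term_ops (S : signature) : smc_ops := {|
  hom := term S;
  idm := tid S;
  comp := @TComp S;
  tens := @TSum S;
  braid := tbraid S |}.

Definition free_prop (S : signature) : PROP :=
  quot_prop (@cong_base (term_ops S) (@smc_axiom (term_ops S))).

Definition free_class (S : signature) n m (t : term S n m) :
  hom (free_prop S) n m := qclass (@smc_axiom (term_ops S)) t.

Lemma hcast_id (H : nat -> nat -> Type) n m (en : n = n) (em : m = m) (f : H n m) :
  hcast en em f = f.
Proof. by rewrite (eq_irrelevance en erefl) (eq_irrelevance em erefl). Qed.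

Lemma hcast_hcast (H : nat -> nat -> Type) n n' n'' m m' m''
    (en : n = n') (en' : n' = n'') (em : m = m') (em' : m' = m'') (f : H n m) :
  hcast en' em' (hcast en em f) = hcast (etrans en en') (etrans em em') f.
Proof. by case: n'' / en'; case: m'' / em'. Qed.

Lemma hcast_comp (D : smc_ops) n n' m m' p p' (en : n = n') (em : m = m')
    (ep : p = p') (g : hom D m p) (f : hom D n m) :
  hcast en ep (g ∘ f) = hcast em ep g ∘ hcast en em f.
Proof. by case: n' / en; case: m' / em; case: p' / ep. Qed.

Lemma hom_map_cast (D Q : smc_ops) (H : prop_hom D Q) n n' m m'
    (en : n = n') (em : m = m') (f : hom D n m) :
  H _ _ (hcast en em f) = hcast en em (H _ _ f).
Proof. by case: n' / en; case: m' / em. Qed.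

Section Coherence.

Context (P : PROP).

Lemma hcast_idm n n' (e : n = n') : hcast e e (idm n : hom P n n) = idm n'.
Proof. by case: n' / e. Qed.

Lemma prop_comp1l n m (f : hom P n m) : idm m ∘ f = f.
Proof. by apply: smc_law; constructor. Qed.

Lemma prop_comp1r n m (f : hom P n m) : f ∘ idm n = f.
Proof. by apply: smc_law; constructor. Qed.

Lemma prop_compA n m p q (h : hom P p q) (g : hom P m p) (f : hom P n m) :
  h ∘ (g ∘ f) = (h ∘ g) ∘ f.
Proof. by apply: smc_law; constructor. Qed.

Lemma prop_braidK n m : braid m n ∘ braid n m = idm (n + m) :> hom P _ _.
Proof. by apply: smc_law; constructor. Qed.

Lemma prop_hexagon n m p :
  braid n (m + p) =
    hcast erefl (addnA m p n) (idm m ⊕ braid n p)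
    ∘ hcast (esym (addnA n m p)) (esym (addnA m n p)) (braid n m ⊕ idm p)
  :> hom P _ _.
Proof. by apply: smc_law; constructor. Qed.

Lemma prop_braidn0 n :
  braid n 0 = hcast erefl (addn0 n) (idm (n + 0)) :> hom P (n + 0) n.
Proof.
have := prop_hexagon n 0 0.
rewrite (smc_law (smc_tens1l (braid n 0 : hom P _ _))).
have := smc_law (smc_tens1r (braid n 0 : hom P _ _)).
move: (braid n 0 ⊕ idm 0) => t ht.
have {}ht : t = hcast (esym (addn0 (n + 0))) (esym (addn0 n)) (braid n 0).
  by rewrite -ht hcast_hcast hcast_id.
rewrite {}ht hcast_id hcast_hcast => /(congr1 (fun f => braid 0 n ∘ f)).
rewrite prop_compA prop_braidK prop_comp1l.
move: (braid n 0) => b h; rewrite h hcast_hcast; exact/esym/hcast_id.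
Qed.

Lemma comp_cast_idm n n' m (e : n = n') (f : hom P n' m) :
  f ∘ hcast erefl e (idm n) = hcast (esym e) erefl f.
Proof. by case: n' / e f => f; rewrite prop_comp1r. Qed.

Lemma cast_idm_comp n m m' (e : m = m') (f : hom P n m) :
  hcast erefl e (idm m) ∘ f = hcast erefl e f.
Proof. by case: m' / e; rewrite prop_comp1l. Qed.

Lemma prop_braid0n n :
  braid 0 n = hcast erefl (esym (addn0 n)) (idm n) :> hom P n (n + 0).
Proof.
have := prop_braidK n 0; rewrite prop_braidn0 comp_cast_idm => h.
have := congr1 (hcast (addn0 n) erefl) h; rewrite hcast_hcast hcast_id => ->.
have e : addn0 n = esym (esym (addn0 n)) by exact: eq_irrelevance.
by rewrite {1}e -comp_cast_idm prop_comp1l.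
Qed.

Lemma prop_hexagon2 n m p :
  braid (n + m) p =
    hcast erefl (esym (addnA p n m)) (braid n p ⊕ idm m)
    ∘ hcast (addnA n m p) (addnA n p m) (idm n ⊕ braid m p)
  :> hom P _ _.
Proof.
set X := RHS.
suff h : X ∘ braid p (n + m) = idm _.
  by rewrite -(prop_comp1l (braid _ _)) -h -prop_compA prop_braidK prop_comp1r.
rewrite /X prop_hexagon prop_compA -(prop_compA _ _ (hcast erefl _ _)).
rewrite -hcast_comp (smc_law (smc_tensM _ _ _ _)) prop_comp1l prop_braidK.
rewrite (smc_law (smc_tens1 _ _ _)) -prop_compA cast_idm_comp hcast_hcast.
rewrite [etrans _ _](_ : _ = esym (addnA p n m)); last exact: eq_irrelevance.
rewrite [etrans _ _](_ : _ = erefl); last exact: eq_irrelevance.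
have -> : hcast erefl (esym (addnA p n m)) (braid n p ⊕ idm m)
    ∘ hcast (esym (addnA p n m)) erefl (braid p n ⊕ idm m) =
  hcast (esym (addnA p n m)) (esym (addnA p n m))
    ((braid n p ⊕ idm m) ∘ (braid p n ⊕ idm m)) :> hom P _ _.
  by rewrite (hcast_comp _ erefl).
rewrite (smc_law (smc_tensM _ _ _ _)) prop_comp1l prop_braidK.
by rewrite (smc_law (smc_tens1 _ _ _)) hcast_idm.
Qed.

End Coherence.

Section Eval.

Context (S : signature) (P : PROP) (phi : forall n m, S n m -> hom P n m).

Fixpoint teval n m (t : term S n m) : hom P n m :=
  match t with
  | TEmpty => idm 0
  | TId => idm 1
  | TBraid => braid 1 1
  | TGen _ _ s => phi s
  | TComp _ _ _ g f => teval g ∘ teval f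
  | TSum _ _ _ _ f g => teval f ⊕ teval g
  end.

Lemma teval_cast n n' m m' (en : n = n') (em : m = m') (t : term S n m) :
  teval (hcast en em t) = hcast en em (teval t).
Proof. by case: n' / en; case: m' / em. Qed.

Lemma teval_tid n : teval (tid S n) = idm n.
Proof.
by elim: n => //= n ->; rewrite (smc_law (smc_tens1 _ 1 n)).
Qed.

Lemma teval_tbraid1 m : teval (tbraid1 S m) = braid 1 m.
Proof.
elim: m => [|m IH] /=; first by rewrite prop_braidn0 hcast_id.
by rewrite IH teval_tid (prop_hexagon P 1 1 m) !hcast_id.
Qed.

Lemma teval_tbraid n m : teval (tbraid S n m) = braid n m.
Proof.
elim: n => [|n IH]; [|cbn -[hcast tbraid1]]; first by rewrite teval_cast teval_tid prop_braid0n.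
rewrite teval_cast /= IH teval_tbraid1 teval_tid (prop_hexagon2 P 1 n m).
rewrite (hcast_comp _ erefl); congr (_ ∘ _).
exact: (esym (hcast_id _ _ _)).
Qed.

Definition teval_hom : prop_hom (term_ops S) P :=
  @PropHom (term_ops S) P teval teval_tid (fun _ _ _ _ _ => erefl)
    (fun _ _ _ _ _ _ => erefl) teval_tbraid.

Lemma teval_axiom n m (f g : term S n m) :
  @smc_axiom (term_ops S) n m f g -> teval_hom n m f = teval_hom n m g.
Proof.
move=> h; apply: smc_law; case: n m f g / h => >;
  rewrite ?(hom_map_cast teval_hom, hom_mapC, hom_mapT, hom_mapI, hom_mapB);
  rewrite ?(hom_map_cast teval_hom, hom_mapC, hom_mapT, hom_mapI, hom_mapB);
  by constructor.
Qed.

Definition free_ext : prop_hom (free_prop S) P :=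
  @quot_lift (term_ops S) P _ teval_hom teval_axiom.

Lemma free_extE n m (t : term S n m) : free_ext n m (free_class t) = teval t.
Proof. exact: (@quot_lift_mapE (term_ops S) P _ teval_hom teval_axiom). Qed.

End Eval.

Lemma free_class_id (S : signature) : free_class (TId : term S 1 1) = idm 1.
Proof.
rewrite -[LHS](smc_law (smc_tens1r _)) hcast_id.
exact: (esym (@qclassT (term_ops S) _ 1 1 0 0 TId TEmpty)).
Qed.

Lemma free_class_braid (S : signature) :
  free_class (TBraid : term S 2 2) = braid 1 1.
Proof.
pose pi : prop_hom (term_ops S) (free_prop S) :=
  quot_pi (@smc_axiom (term_ops S)).
have pi1 : pi 1 1 TId = idm 1 by exact: free_class_id.
have t10 (f : hom (free_prop S) 2 2) : f ⊕ idm 0 = f.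
  by rewrite -[RHS](smc_law (smc_tens1r f)) hcast_id.
have t11 : idm 1 ⊕ idm 1 = idm 2 :> hom (free_prop S) 2 2.
  exact: smc_law (smc_tens1 _ 1 1).
have piC (f g : term S 2 2) : pi 2 2 (TComp f g) = pi 2 2 f ∘ pi 2 2 g.
  exact: (hom_mapC pi).
have piT0 (f : term S 2 2) : pi 2 2 (TSum f TEmpty) = pi 2 2 f.
  by rewrite -[RHS]t10; exact: (@hom_mapT _ _ pi 2 2 0 0 f TEmpty).
have piT1 (f g : term S 1 1) : pi 1 1 f = idm 1 -> pi 1 1 g = idm 1 ->
    pi 2 2 (TSum f g) = idm 2.
  move=> hf hg; rewrite -t11 -{1}hf -hg.
  exact: (@hom_mapT _ _ pi 1 1 1 1).
rewrite -(hom_mapB pi 1 1) -[LHS]/(pi 2 2 TBraid).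
rewrite [RHS](_ : _ = pi 2 2 (TComp
  (TSum (TComp (TSum TId TId) (TSum TBraid TEmpty)) TEmpty : term S 2 2)
  (TSum TId (hcast erefl (esym (addn0 1)) (tid S 1))))); last first.
  by congr (pi _ _ _); apply: hcast_id.
rewrite [RHS]piC piT0 piC piT0 !piT1 ?prop_comp1l ?prop_comp1r //.
by rewrite hcast_id; apply: (hom_mapI pi 1).
Qed.

(* [free_prop] is left adjoint to the underlying-signature functor. *)
Theorem free_universal (S : signature) (P : PROP)
    (phi : forall n m, S n m -> hom P n m) :
  (forall n m (s : S n m), free_ext phi n m (free_class (TGen s)) = phi n m s)
  /\ forall K : prop_hom (free_prop S) P,
    (forall n m (s : S n m), K n m (free_class (TGen s)) = phi n m s) ->
    forall n m (x : hom (free_prop S) n m), K n m x = free_ext phi n m x.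
Proof.
split=> [n m s|K hK n m x]; first by rewrite free_extE.
case: (qclass_surj x) => t ->; rewrite free_extE {x}.
elim: t => {n m} /=.
- exact: (hom_mapI K 0).
- by rewrite -(hom_mapI K 1) -free_class_id.
- by rewrite -(hom_mapB K 1 1) -free_class_braid.
- by move=> n m s; apply: hK.
- by move=> n m p g <- f <-; rewrite -hom_mapC; congr (K _ _ _); apply: qclassC.
- by move=> n m p q f <- g <-; rewrite -hom_mapT; congr (K _ _ _); apply: qclassT.
Qed.

Record theory := Theory {
  generators :> signature;
  equations : forall n m, term generators n m -> term generators n m -> Prop }.

Definition eqn_sig (T : theory) : signature :=
  fun n m => {e : term T n m * term T n m | equations e.1 e.2}.

Definition theory_lhs (T : theory) : prop_hom (free_prop (eqn_sig T)) (free_prop T) :=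
  free_ext (fun n m (e : eqn_sig T n m) => free_class (sval e).1).

Definition theory_rhs (T : theory) : prop_hom (free_prop (eqn_sig T)) (free_prop T) :=
  free_ext (fun n m (e : eqn_sig T n m) => free_class (sval e).2).

Definition theory_prop (T : theory) : PROP := coeq (theory_lhs T) (theory_rhs T).

Inductive sbb_gen : signature :=
| sbb_mu : sbb_gen 2 1
| sbb_eta : sbb_gen 0 1
| sbb_delta : sbb_gen 1 2
| sbb_epsilon : sbb_gen 1 0.

Declare Scope term_scope.
Notation "g ∘ f" := (TComp g f) : term_scope.
Notation "f ⊕ g" := (TSum f g) : term_scope.
Local Notation mu := (@TGen sbb_gen 2 1 sbb_mu).
Local Notation eta := (@TGen sbb_gen 0 1 sbb_eta).
Local Notation delta := (@TGen sbb_gen 1 2 sbb_delta).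
Local Notation epsilon := (@TGen sbb_gen 1 0 sbb_epsilon).
Local Notation empty := TEmpty.
Local Notation id1 := TId.
Local Notation swap := TBraid.

Local Open Scope term_scope.

Inductive sbb_eqn : forall n m, term sbb_gen n m -> term sbb_gen n m -> Prop :=
| sbb_muA : sbb_eqn (mu ∘ (mu ⊕ id1)) (mu ∘ (id1 ⊕ mu))
| sbb_mu_unit : sbb_eqn (mu ∘ (eta ⊕ id1)) id1
| sbb_muC : sbb_eqn (mu ∘ swap) mu
| sbb_deltaA : sbb_eqn ((delta ⊕ id1) ∘ delta) ((id1 ⊕ delta) ∘ delta)
| sbb_delta_counit : sbb_eqn ((epsilon ⊕ id1) ∘ delta) id1
| sbb_deltaC : sbb_eqn (swap ∘ delta) delta
| sbb_delta_mu : sbb_eqn ((mu ⊕ mu) ∘ (id1 ⊕ swap ⊕ id1) ∘ (delta ⊕ delta)) (delta ∘ mu)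
| sbb_epsilon_mu : sbb_eqn (epsilon ∘ mu) (epsilon ⊕ epsilon)
| sbb_delta_eta : sbb_eqn (delta ∘ eta) (eta ⊕ eta)
| sbb_extra : sbb_eqn (epsilon ∘ eta) empty
| sbb_special : sbb_eqn (mu ∘ delta) id1.

Local Close Scope term_scope.

Definition special_bicommutative_bimonoids : theory := Theory sbb_eqn.

Definition rel_ops : smc_ops := {|
  hom := fun n m => {set 'I_n * 'I_m};
  idm := fun n => [set x : 'I_n * 'I_n | x.1 == x.2];
  comp := fun n m p (s : {set 'I_m * 'I_p}) (r : {set 'I_n * 'I_m}) =>
    [set x | [exists j, ((x.1, j) \in r) && ((j, x.2) \in s)]];
  tens := fun n m p q (r : {set 'I_n * 'I_m}) (s : {set 'I_p * 'I_q}) =>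
    [set (lshift p x.1, lshift q x.2) | x in r] :|:
    [set (rshift n x.1, rshift m x.2) | x in s];
  braid := fun n m =>
    [set (lshift m i, rshift m i) | i : 'I_n] :|:
    [set (rshift n j, lshift n j) | j : 'I_m] |}.

Definition nrel n m (r : hom rel_ops n m) (a b : nat) : Prop :=
  exists2 x : 'I_n * 'I_m, x \in r & (x.1 = a :> nat) /\ (x.2 = b :> nat).

Lemma nrel_inj n m (r s : hom rel_ops n m) :
  (forall a b, nrel r a b <-> nrel s a b) -> r = s.
Proof.
move=> h; apply/setP => -[i j].
suff nE (t : hom rel_ops n m) : ((i, j) \in t) <-> nrel t i j.
  by apply/idP/idP => /nE/h/nE.
split=> [ht|[[i' j'] /= ht []]]; first by exists (i, j).
by move=> /val_inj <- /val_inj <-.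
Qed.

Lemma nrel_lt n m (r : hom rel_ops n m) a b : nrel r a b -> (a < n) /\ (b < m).
Proof. by case=> -[i j] /= _ [<- <-]. Qed.

Lemma nrel_cast n n' m m' (en : n = n') (em : m = m') (r : hom rel_ops n m) a b :
  nrel (hcast en em r) a b <-> nrel r a b.
Proof. by case: n' / en; case: m' / em. Qed.

Lemma nrel_idm n a b : nrel (idm n) a b <-> a = b /\ a < n.
Proof.
split=> [[[i j]] | [<- h]].
  by rewrite inE /= => /eqP -> [<- <-].
by exists (Ordinal h, Ordinal h); rewrite ?inE.
Qed.

Lemma nrel_comp n m p (s : hom rel_ops m p) (r : hom rel_ops n m) a b :
  nrel (s ∘ r) a b <-> exists c, nrel r a c /\ nrel s c b.
Proof.
split=> [[[i k]] | [c [[[i j] /= h1 [e1 e2]] [[j' k] /= h2 [e3 e4]]]]].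
  rewrite inE /= => /existsP[j /andP[h1 h2]] [<- <-].
  by exists j; split; [exists (i, j) | exists (j, k)].
exists (i, k) => //; rewrite inE /=; apply/existsP; exists j; rewrite h1.
by have -> : j = j' by apply: val_inj; rewrite /= e2 e3.
Qed.

Lemma nrel_tens n m p q (r : hom rel_ops n m) (s : hom rel_ops p q) a b :
  nrel (r ⊕ s) a b <->
  nrel r a b \/ exists a' b', [/\ a = n + a', b = m + b' & nrel s a' b'].
Proof.
split=> [[x] | [[[i j] h [<- <-]] | [a' [b' [-> -> [[i j] h [<- <-]]]]]]].
- rewrite inE => /orP[] /imsetP[[i j] h ->] /= [<- <-].
    by left; exists (i, j).
  by right; exists i, j; split=> //; exists (i, j).
- exists (lshift p i, lshift q j) => //; rewrite inE; apply/orP; left.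
  by apply/imsetP; exists (i, j).
- exists (rshift n i, rshift m j) => //; rewrite inE; apply/orP; right.
  by apply/imsetP; exists (i, j).
Qed.

Lemma nrel_braid n m a b :
  nrel (braid n m) a b <->
  (a < n /\ b = m + a) \/ (b < m /\ a = n + b).
Proof.
split=> [[x] | [[h ->] | [h ->]]].
- rewrite inE => /orP[] /imsetP[i _ ->] /= [<- <-]; first by left.
  by right.
- exists (lshift m (Ordinal h), rshift m (Ordinal h)) => //.
  by rewrite inE; apply/orP; left; apply/imsetP; exists (Ordinal h).
- exists (rshift n (Ordinal h), lshift n (Ordinal h)) => //.
  by rewrite inE; apply/orP; right; apply/imsetP; exists (Ordinal h).
Qed.

Fact addn_ltF a b : (a + b < a) = false.
Proof. by rewrite ltnNge leq_addr. Qed.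

Lemma rel_law n m (f g : hom rel_ops n m) : smc_axiom f g -> f = g.
Proof.
move=> h; apply: nrel_inj; case: n m f g / h.
- move=> n m p q h g f a b; rewrite !nrel_comp; split.
  + move=> [c [/nrel_comp[d [h1 h2]] h3]].
    by exists d; split=> //; apply/nrel_comp; exists c.
  + move=> [c [h1 /nrel_comp[d [h2 h3]]]].
    by exists d; split=> //; apply/nrel_comp; exists c.
- move=> n m f a b; rewrite nrel_comp; split.
    by move=> [c [h /nrel_idm[<- _]]].
  move=> h; exists b; split=> //; apply/nrel_idm.
  by case: (nrel_lt h).
- move=> n m f a b; rewrite nrel_comp; split.
    by move=> [c [/nrel_idm[<- _] h]].
  move=> h; exists a; split=> //; apply/nrel_idm.
  by case: (nrel_lt h).
- move=> n m a b; rewrite nrel_tens !nrel_idm; split.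
    move=> [[-> h]|[a' [b' [-> -> /nrel_idm[-> h]]]]]; split=> //.
      by rewrite (leq_trans h) ?leq_addr.
    by rewrite ltn_add2l.
  move=> [<- h]; case: (ltnP a n) => han; first by left.
  right; exists (a - n), (a - n); rewrite subnKC //; split=> //.
  by apply/nrel_idm; rewrite ltn_subLR.
- move=> n m p n' m' p' g f g' f' a b; rewrite nrel_comp nrel_tens; split.
    move=> [c [/nrel_tens h1 /nrel_tens h2]].
    case: h1 => [h1|[a1 [c1 [-> e1 h1]]]]; case: h2 => [h2|[c2 [b2 [e2 -> h2]]]].
    + by left; apply/nrel_comp; exists c.
    + by have := nrel_lt h1; rewrite e2 addn_ltF => -[].
    + by have := nrel_lt h2; rewrite e1 addn_ltF => -[].
    + right; exists a1, b2; split=> //; apply/nrel_comp; exists c1; split=> //.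
      by have /eqP := etrans (esym e1) e2; rewrite eqn_add2l => /eqP ->.
  move=> [/nrel_comp[c [h1 h2]]|[a' [b' [-> -> /nrel_comp[c [h1 h2]]]]]].
    by exists c; split; apply/nrel_tens; left.
  exists (m + c); split; apply/nrel_tens; right.
    by exists a', c.
  by exists c, b'.
- move=> n m p q r s f g h a b; rewrite nrel_cast !nrel_tens; split.
    move=> [h1|[a1 [b1 [-> -> /nrel_tens[h1|[a2 [b2 [-> -> h1]]]]]]]].
    + by left; left.
    + by left; right; exists a1, b1.
    + by right; exists a2, b2; rewrite !addnA.
  move=> [[h1|[a1 [b1 [-> -> h1]]]]|[a1 [b1 [-> -> h1]]]]; first by left.
    by right; exists a1, b1; split=> //; apply/nrel_tens; left.
  right; exists (p + a1), (q + b1); rewrite !addnA; split=> //.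
  by apply/nrel_tens; right; exists a1, b1.
- move=> n m f a b; rewrite (nrel_tens (idm 0)); split.
    by move=> [/nrel_lt[]|[a' [b' [-> ->]]]].
  by move=> h; right; exists a, b.
- move=> n m f a b; rewrite nrel_cast nrel_tens; split.
    by move=> [|[a' [b' [_ _ /nrel_lt[]]]]].
  by left.
- move=> n m p q f g a b; rewrite !nrel_comp; split.
    move=> [c [/nrel_tens[h1|[a1 [b1 [-> -> h1]]]] /nrel_braid h2]].
    + have [ha hc] := nrel_lt h1.
      case: h2 => [[_ ->]|[_ e]]; last by rewrite e addn_ltF in hc.
      exists (p + a); split; first by apply/nrel_braid; left.
      by apply/nrel_tens; right; exists a, c.
    + have [ha hb] := nrel_lt h1.
      case: h2 => [[e _]|[_ /eqP]]; first by rewrite addn_ltF in e.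
      rewrite eqn_add2l => /eqP <-.
      exists a1; split; first by apply/nrel_braid; right.
      by apply/nrel_tens; left.
  move=> [c [/nrel_braid h2 /nrel_tens[h1|[a1 [b1 [e1 -> h1]]]]]].
    have [hc hb] := nrel_lt h1.
    case: h2 => [[_ e]|[_ ->]]; first by rewrite e addn_ltF in hc.
    exists (m + b); split; last by apply/nrel_braid; right.
    by apply/nrel_tens; right; exists c, b.
  have [ha hb] := nrel_lt h1.
  case: h2 => [[_ e]|[e _]]; last by rewrite e1 addn_ltF in e.
  have /eqP := etrans (esym e1) e; rewrite eqn_add2l => /eqP <-.
  exists b1; split; last by apply/nrel_braid; left.
  by apply/nrel_tens; left.
- move=> n m a b; rewrite nrel_comp nrel_idm; split.
    move=> [c [/nrel_braid h1 /nrel_braid h2]].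
    case: h1 => [[h e]|[h e]]; case: h2 => [[h' e']|[h' e']].
    + by rewrite e addn_ltF in h'.
    + move/eqP: e'; rewrite e eqn_add2l => /eqP <-; split=> //.
      by rewrite (leq_trans h) ?leq_addr.
    + by rewrite e e' ltn_add2l.
    + by rewrite e' addn_ltF in h.
  move=> [<- h]; case: (ltnP a n) => han.
    by exists (m + a); split; apply/nrel_braid; [left | right].
  have e : a - n < m by rewrite ltn_subLR.
  exists (a - n); split; apply/nrel_braid; [right | left];
    by rewrite ?subnKC.
- move=> n m p a b; rewrite nrel_comp nrel_braid; split.
    move=> [[h ->]|[h ->]].
      exists (m + a); split.
        by apply/nrel_cast/nrel_tens; left; apply/nrel_braid; left.
      apply/nrel_cast/nrel_tens; right; exists a, (p + a); rewrite addnA.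
      by split=> //; apply/nrel_braid; left.
    case: (ltnP b m) => hb.
      exists b; split.
        by apply/nrel_cast/nrel_tens; left; apply/nrel_braid; right.
      by apply/nrel_cast/nrel_tens; left; apply/nrel_idm.
    have e : b - m < p by rewrite ltn_subLR.
    exists (n + b); split.
      apply/nrel_cast/nrel_tens; right; exists (b - m), (b - m).
      split; [by rewrite -addnA subnKC | | by apply/nrel_idm].
      by rewrite (addnC m) -addnA subnKC.
    apply/nrel_cast/nrel_tens; right; exists (n + (b - m)), (b - m).
    split; [by rewrite addnCA subnKC | by rewrite subnKC |].
    by apply/nrel_braid; right.
  move=> [c [/nrel_cast/nrel_tens h1 /nrel_cast/nrel_tens h2]].
  case: h1 => [/nrel_braid[[h ec]|[h ea]]|[a1 [c1 [ea ec /nrel_idm[e1 h]]]]];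
    case: h2 => [/nrel_idm[e2 h']|[c2 [b2 [e2 eb /nrel_braid[[h' e3]|[h' e3]]]]]].
  + by rewrite ec addn_ltF in h'.
  + left; split=> //; move/eqP: ec; rewrite e2 eqn_add2l => /eqP <-.
    by rewrite eb e3 addnA.
  + move/eqP: ec; rewrite e2 e3 eqn_add2l => /eqP ec.
    by rewrite -ec addn_ltF in h.
  + by right; rewrite -e2 ea (leq_trans h) ?leq_addr.
  + by rewrite e2 addn_ltF in h.
  + by rewrite e2 addn_ltF in h.
  + by rewrite ec -addnA addn_ltF in h'.
  + move/eqP: ec; rewrite e2 -addnA eqn_add2l => /eqP ec.
    by rewrite ec addn_ltF in h'.
  + move/eqP: ec; rewrite e2 -addnA eqn_add2l e3 eqn_add2l => /eqP ec.
    by right; rewrite eb ltn_add2l ec -e1 ea addnA.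
Qed.

Definition Rel : PROP := Prop_of_ops rel_law.

(* Main.v *)
From mathcomp Require Import all_boot boolp.
Require Import Defs.

Set Implicit Arguments.
Unset Strict Implicit.
Unset Printing Implicit Defensive.

Local Open Scope smc_scope.

(** The prop T of special bicommutative bimonoids maps to relations by sending
    each of the four generators to the full relation of its type; the eleven
    equations hold there by a finite computation.  Since a morphism of props
    that is bijective on every hom-set has an inverse that is again a morphism
    of props, it suffices to see that this map is bijective.

    A boolean matrix r of size n x m is drawn in T as a diagram [mat n m r],
    one input at a time.  A column a of length m gives [column m a : 1+m -> m],
    which copies its first input, adds a copy to the output j whenever a j
    holds, and finally discards it.  With [zero m : 0 -> m] this gives
      mat 0 m r = zero m,   mat (1+n) m r = column m (r 0) o (id + mat n m r'),
    where r' is r without its first row, and the image of [mat n m r] is the relation r ([nrel_mat]).  So every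
    relation is hit, and two matrix diagrams with the same image are equal.

    What remains is that every morphism of T is a matrix diagram
    ([mat_sliced]).  For this it is enough that every f is [linear]: f maps
    [zero] to [zero], and f o column a = column a' o (id + f) for some column
    a'.  Pushing f through a matrix diagram then replaces each column by
    another one, and f = f o id is a matrix diagram because id is one.
    Linearity passes to composites and to id + f, so it is needed only for
    each generator and the braiding with identity wires added on the right.
    There it comes down to one identity between small diagrams for each
    ([del_add], [dup_add], [mul_add], [swp_add]; a wire created by the unit
    only needs an extra 0 in the column): these are the main places where
    the equations of the theory do their work.

    These identities only involve diagrams of the shapes id_1 + f and g + id_k
    with g of fixed arity, so the types on both sides agree by computation and
    strict associativity calls for no transport.

    Below, the wires of a diagram are read as variables: mul maps (x, y) to
    x+y, dup maps x to (x, x), swp maps (x, y) to (y, x), all further wires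
    being left alone; id_1 + f is [whisk f], or w f. *)

(** * Whiskering by wires on the left and on the right *)

Section Slices.

Context (P : PROP).

(** With composites kept associated to the right, an equation applies in the
    middle of a composite only when it is stated with a tail h; this and its
    longer variants supply the tail. *)
Lemma precomp n m p (b : hom P m p) (a : hom P n m) c (e : b ∘ a = c) l
    (h : hom P l n) :
  b ∘ (a ∘ h) = c ∘ h.
Proof. by rewrite prop_compA e. Qed.

Lemma precomp3 n m p q (c : hom P p q) (b : hom P m p) (a : hom P n m) d
    (e : c ∘ (b ∘ a) = d) l (h : hom P l n) :
  c ∘ (b ∘ (a ∘ h)) = d ∘ h.
Proof. by rewrite -e -!prop_compA. Qed.

Lemma precomp4 n m p q r (x : hom P q r) (c : hom P p q) (b : hom P m p)
    (a : hom P n m) d (e : x ∘ (c ∘ (b ∘ a)) = d) l (h : hom P l n) :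
  x ∘ (c ∘ (b ∘ (a ∘ h))) = d ∘ h.
Proof. by rewrite -e -!prop_compA. Qed.

Definition whisk n m (f : hom P n m) : hom P n.+1 m.+1 := idm 1 ⊕ f.

Lemma whiskC n m p (g : hom P m p) (f : hom P n m) :
  whisk (g ∘ f) = whisk g ∘ whisk f.
Proof.
have := smc_law (smc_tensM (idm 1 : hom P 1 1) (idm 1) g f).
by rewrite prop_comp1l.
Qed.

Lemma whisk_eq n m p (g : hom P m p) (f : hom P n m) h :
  g ∘ f = h -> whisk g ∘ whisk f = whisk h.
Proof. by rewrite -whiskC => ->. Qed.

Lemma whiskI n : whisk (idm n) = idm n.+1.
Proof. exact: smc_law (smc_tens1 _ 1 n). Qed.

Lemma tens1S n p q (h : hom P p q) : idm n.+1 ⊕ h = whisk (idm n ⊕ h).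
Proof.
have := smc_law (smc_tensA (idm 1 : hom P _ _) (idm n) h).
by rewrite hcast_id (smc_law (smc_tens1 _ 1 n)) => <-.
Qed.

Lemma tens2l p q (h : hom P p q) : idm 2 ⊕ h = whisk (whisk h).
Proof. by rewrite tens1S. Qed.

Lemma tens0l p q (h : hom P p q) : idm 0 ⊕ h = h.
Proof. exact: smc_law (smc_tens1l h). Qed.

Lemma padC k n m p (g : hom P m p) (f : hom P n m) :
  (g ∘ f) ⊕ idm k = (g ⊕ idm k) ∘ (f ⊕ idm k).
Proof. by rewrite (smc_law (smc_tensM _ _ _ _)) prop_comp1l. Qed.

(** Both types below are the same by computation, which is what makes left
    whiskering by a single wire and right whiskering by k wires the convenient
    pair of operations. *)
Lemma pad_whisk k n m (f : hom P n m) :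
  whisk f ⊕ idm k = whisk (f ⊕ idm k) :> hom P (n.+1 + k) (m.+1 + k).
Proof.
have := smc_law (smc_tensA (idm 1) f (idm k : hom P _ _)).
by rewrite hcast_id => <-.
Qed.

Lemma pad_pad j k n m (f : hom P n m) :
  (f ⊕ idm j) ⊕ idm k
  = hcast (addnA n j k) (addnA m j k) (f ⊕ idm (j + k)).
Proof.
by rewrite -(smc_law (smc_tensA _ _ _)) (smc_law (smc_tens1 _ _ _)).
Qed.

Lemma pad_nat n m p q (f : hom P n m) (h : hom P p q) :
  (f ⊕ idm q) ∘ (idm n ⊕ h) = (idm m ⊕ h) ∘ (f ⊕ idm p).
Proof.
by rewrite !(smc_law (smc_tensM _ _ _ _)) !(prop_comp1l, prop_comp1r).
Qed.

Lemma tens_split n m p q (f : hom P n m) (h : hom P p q) :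
  f ⊕ h = (f ⊕ idm q) ∘ (idm n ⊕ h).
Proof.
by rewrite !(smc_law (smc_tensM _ _ _ _)) !(prop_comp1l, prop_comp1r).
Qed.

End Slices.

(** * Every term is a composite of slices *)

Section Sliced.

Context (S : signature) (P : PROP) (phi : forall n m, S n m -> hom P n m).

(** Generation without a general tensor product: one wire is added on the left
    at a time, and wires on the right only directly to a generator, so that an
    induction on [sliced] meets no associativity of the sum. *)
Inductive sliced : forall n m, hom P n m -> Prop :=
| sliced_id n : sliced (idm n)
| sliced_comp n m p (g : hom P m p) (f : hom P n m) :
    sliced g -> sliced f -> sliced (g ∘ f)
| sliced_whisk n m (f : hom P n m) : sliced f -> sliced (whisk f)
| sliced_braid k : sliced (braid 1 1 ⊕ idm k)
| sliced_gen n m (s : S n m) k : sliced (phi s ⊕ idm k).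

Lemma sliced_cast n n' m m' (en : n = n') (em : m = m') (f : hom P n m) :
  sliced f -> sliced (hcast en em f).
Proof. by case: n' / en; case: m' / em. Qed.

Lemma sliced_tensr n p q (f : hom P p q) : sliced f -> sliced (idm n ⊕ f).
Proof.
move=> hf; elim: n => [|n IH]; first by rewrite tens0l.
by rewrite tens1S; apply: sliced_whisk.
Qed.

Lemma sliced_pad k n m (f : hom P n m) : sliced f -> sliced (f ⊕ idm k).
Proof.
elim=> {n m f} [n|n m p g f _ hg _ hf|n m f _ hf|j|n m s j].
- by rewrite (smc_law (smc_tens1 _ _ _)); apply: sliced_id.
- by rewrite padC; apply: sliced_comp.
- by rewrite pad_whisk; apply: sliced_whisk.
- by rewrite pad_pad; apply/sliced_cast/sliced_braid.
- by rewrite pad_pad; apply/sliced_cast/sliced_gen.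
Qed.

Lemma sliced_unpad n m (f : hom P n m) : sliced (f ⊕ idm 0) -> sliced f.
Proof.
by move=> h; rewrite -(smc_law (smc_tens1r f)); apply: sliced_cast.
Qed.

Lemma sliced_teval n m (t : term S n m) : sliced (teval phi t).
Proof.
elim: t => {n m} /= [||| n m s |n m p g hg f hf|n m p q f hf g hg].
- exact: sliced_id.
- exact: sliced_id.
- exact/sliced_unpad/sliced_braid.
- exact/sliced_unpad/sliced_gen.
- exact: sliced_comp.
- rewrite tens_split; apply: sliced_comp; first exact: sliced_pad.
  exact: sliced_tensr.
Qed.

End Sliced.

(** * Slices of the generators *)

Section Bimonoid.

Context (P : PROP) (phi : forall n m, sbb_gen n m -> hom P n m).

Definition swp k : hom P k.+2 k.+2 := braid 1 1 ⊕ idm k.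
Definition mul k : hom P k.+2 k.+1 := phi sbb_mu ⊕ idm k.
Definition nul k : hom P k k.+1 := phi sbb_eta ⊕ idm k.
Definition dup k : hom P k.+1 k.+2 := phi sbb_delta ⊕ idm k.
Definition del k : hom P k.+1 k := phi sbb_epsilon ⊕ idm k.

Notation w := whisk.

Lemma swp_nat n m (f : hom P n m) : swp m ∘ w (w f) = w (w f) ∘ swp n.
Proof. by have := pad_nat (braid 1 1) f; rewrite tens2l. Qed.

Lemma mul_nat n m (f : hom P n m) : mul m ∘ w (w f) = w f ∘ mul n.
Proof. by have := pad_nat (phi sbb_mu) f; rewrite tens2l. Qed.

Lemma dup_nat n m (f : hom P n m) : dup m ∘ w f = w (w f) ∘ dup n.
Proof. by have := pad_nat (phi sbb_delta) f; rewrite tens2l. Qed.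

Lemma nul_nat n m (f : hom P n m) : nul m ∘ f = w f ∘ nul n.
Proof. by have := pad_nat (phi sbb_eta) f; rewrite tens0l. Qed.

Lemma del_nat n m (f : hom P n m) : del m ∘ w f = f ∘ del n.
Proof. by have := pad_nat (phi sbb_epsilon) f; rewrite tens0l. Qed.

Lemma swpK k : swp k ∘ swp k = idm k.+2.
Proof.
have := padC k (braid 1 1 : hom P _ _) (braid 1 1).
by rewrite prop_braidK (smc_law (smc_tens1 _ _ _)).
Qed.

Lemma pad_braid01 k : (braid 0 1 : hom P 1 1) ⊕ idm k = idm k.+1.
Proof.
by rewrite prop_braid0n hcast_id; apply: (smc_law (smc_tens1 _ 1 k)).
Qed.

Lemma pad_braid21 k :
  (braid 2 1 : hom P 3 3) ⊕ idm k = swp k.+1 ∘ w (swp k) :> hom P k.+3 k.+3.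
Proof.
rewrite (prop_hexagon2 P 1 1 1) !hcast_id padC.
rewrite (pad_pad 1 k (braid 1 1 : hom P 2 2)) hcast_id.
by rewrite (pad_whisk k (braid 1 1 : hom P 2 2)).
Qed.

(** Naturality of the braiding with respect to f, with one wire passing over f;
    unfolding the braidings for each small arity gives the rules for moving a
    generator across a crossing. *)
Lemma pad_slide k n m (f : hom P n m) :
  (braid m 1 ⊕ idm k) ∘ ((f ⊕ idm 1) ⊕ idm k) =
  (w f ⊕ idm k) ∘ (braid n 1 ⊕ idm k).
Proof. by rewrite -!padC (smc_law (smc_braid_nat _ _)). Qed.

Lemma swp_mul k : swp k ∘ mul k.+1 = w (mul k) ∘ (swp k.+1 ∘ w (swp k)).
Proof.
have := pad_slide k (phi sbb_mu).
by rewrite pad_pad hcast_id pad_braid21 pad_whisk.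
Qed.

Lemma slide22 k (f : hom P 2 2) :
  (swp k.+1 ∘ w (swp k)) ∘ (f ⊕ idm k.+1) =
  w (f ⊕ idm k) ∘ (swp k.+1 ∘ w (swp k)).
Proof.
have := pad_slide k f.
by rewrite pad_pad hcast_id pad_braid21 pad_whisk.
Qed.

Lemma swp_dup k : (swp k.+1 ∘ w (swp k)) ∘ dup k.+1 = w (dup k) ∘ swp k.
Proof.
have := pad_slide k (phi sbb_delta).
by rewrite pad_pad hcast_id pad_braid21 pad_whisk.
Qed.

Lemma swp_nul k : swp k ∘ nul k.+1 = w (nul k).
Proof.
have := pad_slide k (phi sbb_eta).
by rewrite pad_pad hcast_id pad_braid01 pad_whisk prop_comp1r.
Qed.

Lemma swp_del k : del k.+1 = w (del k) ∘ swp k.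
Proof.
have := pad_slide k (phi sbb_epsilon).
by rewrite pad_pad hcast_id pad_braid01 pad_whisk prop_comp1l.
Qed.

(* From here on phi is a special bicommutative bimonoid in P. *)

Context (phi_law : forall n m (s t : term sbb_gen n m),
  sbb_eqn s t -> teval phi s = teval phi t).

Lemma mulA k : mul k ∘ mul k.+1 = mul k ∘ w (mul k).
Proof.
have := congr1 (fun f => f ⊕ idm k) (phi_law sbb_muA).
by rewrite /= !padC (pad_whisk k (phi sbb_mu)) (pad_pad 1 k (phi sbb_mu)) hcast_id.
Qed.

Lemma mul0l k : mul k ∘ nul k.+1 = idm k.+1.
Proof.
have := congr1 (fun f => f ⊕ idm k) (phi_law sbb_mu_unit).
by rewrite /= !padC (pad_pad 1 k (phi sbb_eta)) hcast_id (smc_law (smc_tens1 _ 1 k)).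
Qed.

Lemma mulC k : mul k ∘ swp k = mul k.
Proof.
have := congr1 (fun f => f ⊕ idm k) (phi_law sbb_muC).
by rewrite /= padC.
Qed.

Lemma dupA k : dup k.+1 ∘ dup k = w (dup k) ∘ dup k.
Proof.
have := congr1 (fun f => f ⊕ idm k) (phi_law sbb_deltaA).
by rewrite /= !padC (pad_whisk k (phi sbb_delta)) (pad_pad 1 k (phi sbb_delta)) hcast_id.
Qed.

Lemma dup_dell k : del k.+1 ∘ dup k = idm k.+1.
Proof.
have := congr1 (fun f => f ⊕ idm k) (phi_law sbb_delta_counit).
by rewrite /= !padC (pad_pad 1 k (phi sbb_epsilon)) hcast_id (smc_law (smc_tens1 _ 1 k)).
Qed.

Lemma dupC k : swp k ∘ dup k = dup k.
Proof.
have := congr1 (fun f => f ⊕ idm k) (phi_law sbb_deltaC).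
by rewrite /= padC.
Qed.

Lemma dup_mul k : dup k ∘ mul k =
  mul k.+1 ∘ (w (w (mul k)) ∘ (w (swp k.+1) ∘ (dup k.+2 ∘ w (dup k)))).
Proof.
have := congr1 (fun f => f ⊕ idm k) (phi_law sbb_delta_mu).
rewrite /= !padC (tens_split (phi sbb_mu)) (tens_split (phi sbb_delta)).
rewrite !padC !tens2l !pad_whisk !pad_pad !hcast_id -!prop_compA => <-.
by rewrite (pad_pad 1 k (braid 1 1 : hom P _ _)) (pad_pad 2 k (phi sbb_delta)) !hcast_id.
Qed.

Lemma del_mul k : del k ∘ mul k = del k ∘ del k.+1.
Proof.
have e : (phi sbb_epsilon ⊕ phi sbb_epsilon) ⊕ idm k = del k ∘ w (del k).
  rewrite (tens_split (phi sbb_epsilon)) padC pad_pad hcast_id.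
  by rewrite (pad_whisk k (phi sbb_epsilon)).
have := congr1 (fun f => f ⊕ idm k) (phi_law sbb_epsilon_mu).
by rewrite /= padC -del_nat -e.
Qed.

Lemma dup_nul k : dup k ∘ nul k = nul k.+1 ∘ nul k.
Proof.
have e : (phi sbb_eta ⊕ phi sbb_eta) ⊕ idm k = nul k.+1 ∘ nul k.
  by rewrite (tens_split (phi sbb_eta)) padC pad_pad hcast_id tens0l.
have := congr1 (fun f => f ⊕ idm k) (phi_law sbb_delta_eta).
by rewrite /= padC -e.
Qed.

Lemma del_nul k : del k ∘ nul k = idm k.
Proof.
have := congr1 (fun f => f ⊕ idm k) (phi_law sbb_extra).
by rewrite /= padC (tens0l (idm k)).
Qed.

Lemma mul_dup k : mul k ∘ dup k = idm k.+1.
Proof.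
have := congr1 (fun f => f ⊕ idm k) (phi_law sbb_special).
by rewrite /= padC (smc_law (smc_tens1 _ 1 k)).
Qed.

(* The slides from the other side follow, the braiding being an involution. *)

Lemma swp_wmul k : swp k ∘ w (mul k) = mul k.+1 ∘ (w (swp k) ∘ swp k.+1).
Proof.
rewrite -[mul k.+1]prop_comp1l -swpK -!prop_compA (precomp (swp_mul k)).
rewrite -!prop_compA (precomp (whisk_eq (swpK k))) whiskI prop_comp1l swpK.
by rewrite prop_comp1r.
Qed.

Lemma dup_swp k : dup k.+1 ∘ swp k = w (swp k) ∘ (swp k.+1 ∘ w (dup k)).
Proof.
rewrite -[w (dup k)]prop_comp1r -swpK (precomp (esym (swp_dup k))).
rewrite -!prop_compA (precomp (swpK _)) prop_comp1l.
by rewrite (precomp (whisk_eq (swpK k))) whiskI prop_comp1l.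
Qed.

Lemma swp_wnul k : swp k ∘ w (nul k) = nul k.+1.
Proof. by rewrite -swp_nul prop_compA swpK prop_comp1l. Qed.

Lemma del_swp k : del k.+1 ∘ swp k = w (del k).
Proof. by rewrite swp_del -prop_compA swpK prop_comp1r. Qed.

Lemma mul0r k : mul k ∘ w (nul k) = idm k.+1.
Proof. by rewrite -mulC -prop_compA swp_wnul mul0l. Qed.

Lemma dup_delr k : w (del k) ∘ dup k = idm k.+1.
Proof. by rewrite -del_swp -prop_compA dupC dup_dell. Qed.

(** * The controlled addition *)

(** The diagram (x, y) to (x, x+y) if b holds, and the identity otherwise. *)
Definition ctl2 (b : bool) : hom P 2 2 :=
  if b then w (phi sbb_mu) ∘ (phi sbb_delta ⊕ idm 1) else idm 2.

Definition ctl b k : hom P k.+2 k.+2 := ctl2 b ⊕ idm k.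

Lemma ctlF k : ctl false k = idm k.+2.
Proof. exact: (smc_law (smc_tens1 _ 2 k)). Qed.

Lemma ctlT k : ctl true k = w (mul k) ∘ dup k.+1.
Proof.
rewrite /ctl padC pad_whisk (pad_pad 1 k (phi sbb_delta)) hcast_id.
by [].
Qed.

Lemma ctl_nat b n m (f : hom P n m) : ctl b m ∘ w (w f) = w (w f) ∘ ctl b n.
Proof. by have := pad_nat (ctl2 b) f; rewrite tens2l. Qed.

Lemma wmul_ctl b k : w (mul k) ∘ ctl b k.+1 = ctl b k ∘ w (mul k).
Proof.
case: b; last by rewrite !ctlF prop_comp1l prop_comp1r.
rewrite !ctlT -!prop_compA dup_nat.
by rewrite !(precomp (whisk_eq erefl)) mulA.
Qed.

(** Adding x twice is adding it once, as x+x = x: here the special law makes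
    the coefficients boolean. *)
Lemma ctlTT k : ctl true k ∘ ctl true k = ctl true k.
Proof.
rewrite !ctlT -prop_compA (precomp (dup_nat _)) -prop_compA dupA.
rewrite (precomp (whisk_eq (esym (mulA k)))) whiskC -prop_compA.
by rewrite (precomp (whisk_eq (mul_dup _))) whiskI prop_comp1l.
Qed.

Lemma yang_baxter k :
  swp k.+1 ∘ (w (swp k) ∘ swp k.+1) = w (swp k) ∘ (swp k.+1 ∘ w (swp k)).
Proof. by rewrite prop_compA (slide22 k (braid 1 1)). Qed.

(** Both sides send (x, y, z) to (y+bx+z, x) up to the order of the summands.
    For b true they meet in the diagram that copies x, moves one copy past y
    and z, and adds the other three wires. *)
Lemma mul_swp_ctl b k :
  mul k.+1 ∘ (w (swp k) ∘ (w (ctl b k) ∘ swp k.+1)) =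
  swp k ∘ (ctl b k ∘ w (mul k)).
Proof.
case: b; last by rewrite ctlF whiskI !prop_comp1l swp_wmul.
pose y := mul k.+1 ∘ (w (mul k.+1) ∘
  (w (w (swp k)) ∘ (w (swp k.+1) ∘ dup k.+2))).
transitivity y.
  rewrite ctlT whiskC -!prop_compA -swp_dup -prop_compA.
  rewrite (precomp (whisk_eq (swp_wmul k))) !whiskC -!prop_compA.
  rewrite (precomp3 (esym (yang_baxter _))) -!prop_compA dupC.
  rewrite (precomp (esym (swp_nat _))) -prop_compA (precomp (esym (mulA _))) -prop_compA.
  by rewrite (precomp (mulC _)) (precomp (mulA _)) -prop_compA.
rewrite ctlT -!prop_compA (precomp (swp_wmul k)) -!prop_compA dup_nat.
rewrite (precomp (swp_nat (mul k))) -prop_compA dupC.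
by rewrite (precomp (whisk_eq (swp_wmul k))) !whiskC -!prop_compA.
Qed.

(** One step of [column]: (x, y) goes to (y+bx, x), so that the wire x moves on
    to the next output.  The case distinction on b, rather than a composite
    with [ctl b], keeps rewriting with associativity from looking inside. *)
Definition add (b : bool) k : hom P k.+2 k.+2 :=
  if b then swp k ∘ ctl true k else swp k.

Lemma addE b k : add b k = swp k ∘ ctl b k.
Proof. by case: b; rewrite ?ctlF ?prop_comp1r. Qed.

Lemma add_nat b n m (f : hom P n m) : add b m ∘ w (w f) = w (w f) ∘ add b n.
Proof. by rewrite !addE -prop_compA ctl_nat !prop_compA swp_nat. Qed.

Lemma del_add b k : del k.+1 ∘ add b k = w (del k).
Proof.
rewrite !addE prop_compA del_swp; case: b; last by rewrite ctlF prop_comp1r.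
rewrite ctlT prop_compA (whisk_eq (del_mul k)) whiskC -prop_compA.
by rewrite dup_delr prop_comp1r.
Qed.

Lemma wswp_dup2 k n (h : hom P n k.+1) :
  w (swp k) ∘ (dup k.+1 ∘ (dup k ∘ h)) = dup k.+1 ∘ (dup k ∘ h).
Proof.
by rewrite !(precomp (dupA k)) -!prop_compA (precomp (whisk_eq (dupC k))).
Qed.

(** (x, y) goes to (y+bx, y+bx, x): duplicating the output is duplicating the
    coefficient b.  For b true this rests on the bimonoid law for dup after mul. *)
Lemma dup_add b k :
  dup k.+1 ∘ add b k = w (add b k) ∘ (add b k.+1 ∘ w (dup k)).
Proof.
case: b; last by rewrite dup_swp.
rewrite !addE whiskC (precomp (dup_swp k)) -!prop_compA; congr (_ ∘ _).
(* The common form makes all copies first: from (x, x, x, y, y) to (x, x+y,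
   x+y), and then one x+y crosses x. *)
transitivity (swp k.+1 ∘ (w (mul k.+1) ∘ (w (w (w (mul k))) ∘
  (w (w (swp k.+1)) ∘ (dup k.+3 ∘ (dup k.+2 ∘ w (dup k))))))).
  rewrite ctlT (precomp (whisk_eq (dup_mul k))) !whiskC -!prop_compA.
  by rewrite -dup_nat (precomp (esym (dupA _))) -prop_compA.
rewrite !ctlT whiskC -!prop_compA (precomp (esym (swp_dup _))) -!prop_compA.
rewrite (precomp (dup_nat (mul k.+1))) -prop_compA.
rewrite (precomp (whisk_eq (swp_wmul k.+1))) !whiskC -!prop_compA.
rewrite wswp_dup2 (precomp (esym (swp_nat (mul k)))) -!prop_compA.
by rewrite (precomp (whisk_eq (esym (mul_nat (mul k))))) whiskC -prop_compA.
Qed.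

(** (x, y, z) goes to (y+b1 x+z+b2 x, x): adding two outputs adds their
    coefficients in the boolean semiring. *)
Lemma mul_add b1 b2 k :
  mul k.+1 ∘ (w (add b2 k) ∘ add b1 k.+1) = add (b1 || b2) k ∘ w (mul k).
Proof.
rewrite !addE whiskC -!prop_compA (precomp4 (mul_swp_ctl b2 k)) -!prop_compA.
rewrite wmul_ctl; congr (_ ∘ _).
case: b1 => /=; last by rewrite ctlF prop_comp1l.
by case: b2; rewrite ?ctlF ?prop_comp1l // (precomp (ctlTT k)).
Qed.

(** Adding b1 x to y and adding b2 x to z commute; conjugation by w swp turns a
    controlled addition on the first two wires into one on wires 1 and 3. *)
Lemma ctl_comm b1 b2 k :
  ctl b1 k.+1 ∘ (w (swp k) ∘ ctl b2 k.+1) =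
  w (swp k) ∘ (ctl b2 k.+1 ∘ (w (swp k) ∘ (ctl b1 k.+1 ∘ w (swp k)))).
Proof.
have wSS n (h : hom P n k.+3) : w (swp k) ∘ (w (swp k) ∘ h) = h.
  by rewrite (precomp (whisk_eq (swpK k))) whiskI prop_comp1l.
case: b1; last first.
  by rewrite ctlF !prop_comp1l (whisk_eq (swpK k)) whiskI prop_comp1r.
case: b2; last by rewrite ctlF prop_comp1l prop_comp1r wSS.
(* Direct form of the addition of x to the third wire. *)
have V n (h : hom P n k.+3) :
    w (swp k) ∘ (ctl true k.+1 ∘ (w (swp k) ∘ h)) =
    w (w (mul k)) ∘ (w (swp k.+1) ∘ (dup k.+2 ∘ h)).
  rewrite ctlT -prop_compA (precomp (dup_nat (swp k))) -prop_compA.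
  rewrite (precomp (whisk_eq (swp_mul k))) !whiskC -!prop_compA.
  by rewrite (precomp (whisk_eq (whisk_eq (swpK k)))) !whiskI prop_comp1l.
(* Bring the left side to the form where V applies there too. *)
rewrite V -[LHS]prop_comp1r -[idm k.+3](wSS _ (idm _)) prop_comp1r -!prop_compA.
rewrite V ctlT -!prop_compA.
rewrite (precomp (dup_nat (w (mul k)))) (precomp (dup_nat (mul k.+1))).
rewrite -!prop_compA (precomp (dup_nat (swp k.+1))) -!prop_compA.
rewrite (precomp (whisk_eq (swp_wmul k.+1))) !whiskC -!prop_compA.
rewrite wswp_dup2.
by rewrite (precomp (whisk_eq (esym (mul_nat (mul k))))) whiskC -prop_compA.
Qed.

Lemma slide_ctl b k :
  w (ctl b k) ∘ swp k.+1 =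
  swp k.+1 ∘ (w (swp k) ∘ (ctl b k.+1 ∘ w (swp k))).
Proof.
have := slide22 k (ctl2 b); rewrite -prop_compA => /precomp3 ->.
by rewrite -!prop_compA (whisk_eq (swpK k)) whiskI prop_comp1r.
Qed.

(** Exchanging two outputs exchanges their coefficients. *)
Lemma swp_add b1 b2 k :
  swp k.+1 ∘ (w (add b2 k) ∘ add b1 k.+1) =
  w (add b1 k) ∘ (add b2 k.+1 ∘ w (swp k)).
Proof.
rewrite !addE !whiskC -!prop_compA !(precomp (slide_ctl _ _)) -!prop_compA.
rewrite (precomp3 (yang_baxter _)) -!prop_compA
  (precomp (whisk_eq (swpK k))) whiskI prop_comp1l.
by rewrite ctl_comm.
Qed.

(** * Matrix diagrams *)

Fixpoint zero m : hom P 0 m :=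
  if m is k.+1 then nul k ∘ zero k else idm 0.

(** Columns are functions on all of nat so that dropping the first entry is a
    shift; only the values below m matter ([eq_column]). *)
Fixpoint column m (a : nat -> bool) : hom P m.+1 m :=
  if m is k.+1 then w (column k (fun i => a i.+1)) ∘ add (a 0) k else del 0.

Fixpoint mat n m (r : nat -> nat -> bool) : hom P n m :=
  if n is k.+1 then column m (r 0) ∘ w (mat k m (fun i => r i.+1)) else zero m.

Lemma eq_column m a a' : (forall i, i < m -> a i = a' i) -> column m a = column m a'.
Proof.
elim: m a a' => //= m IH a a' e.
by rewrite e // (IH _ (fun i => a' i.+1)) // => i hi; apply: e.
Qed.

Lemma eq_mat n m r r' :
  (forall i j, i < n -> j < m -> r i j = r' i j) -> mat n m r = mat n m r'.
Proof.
elim: n r r' => //= n IH r r' e.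
rewrite (@eq_column m _ (r' 0)) => [|j hj]; last exact: e.
by rewrite (IH _ (fun i => r' i.+1)) // => i j hi hj; apply: e.
Qed.

Definition ncons (b : bool) (a : nat -> bool) i := if i is j.+1 then a j else b.

(** * Every diagram is linear *)

(** This contains just what is needed to push f through [mat]; a' need not be
    identified. *)
Definition linear n m (f : hom P n m) :=
  f ∘ zero n = zero m /\
  forall a, exists a', f ∘ column n a = column m a' ∘ w f.

Lemma linear_id n : linear (idm n).
Proof.
split=> [|a]; first by rewrite prop_comp1l.
by exists a; rewrite whiskI prop_comp1l prop_comp1r.
Qed.

Lemma linear_comp n m p (g : hom P m p) (f : hom P n m) :
  linear g -> linear f -> linear (g ∘ f).
Proof.
move=> [g0 ga] [f0 fa]; split=> [|a]; first by rewrite -prop_compA f0.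
have [b eb] := fa a; have [c ec] := ga b; exists c.
by rewrite -prop_compA eb prop_compA ec -prop_compA whiskC.
Qed.

Lemma linear_whisk n m (f : hom P n m) : linear f -> linear (w f).
Proof.
move=> [f0 fa]; split=> [|a] /=; first by
  rewrite (precomp (esym (nul_nat f))) -prop_compA f0.
have [b eb] := fa (fun i => a i.+1); exists (ncons (a 0) b) => /=.
by rewrite (precomp (whisk_eq eb)) whiskC -!prop_compA add_nat.
Qed.

Lemma linear_swp k : linear (swp k).
Proof.
split=> [|a] /=; first by
  rewrite (precomp (swp_nul _)) (precomp (esym (nul_nat (nul k)))) -prop_compA.
exists (ncons (a 1) (ncons (a 0) (fun i => a i.+2))) => /=.
rewrite !whiskC -!prop_compA (precomp (swp_nat _)) -!prop_compA.
by rewrite swp_add.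
Qed.

Lemma linear_mul k : linear (mul k).
Proof.
split=> [|a] /=; first by rewrite (precomp (mul0l _)) prop_comp1l.
exists (ncons (a 0 || a 1) (fun i => a i.+2)) => /=.
rewrite !whiskC -!prop_compA (precomp (mul_nat _)) -!prop_compA.
by rewrite mul_add.
Qed.

Lemma linear_dup k : linear (dup k).
Proof.
split=> [|a] /=; first by rewrite (precomp (dup_nul _)) -prop_compA.
exists (ncons (a 0) a) => /=.
rewrite !whiskC -!prop_compA (precomp (dup_nat _)) -!prop_compA.
by rewrite dup_add.
Qed.

Lemma linear_nul k : linear (nul k).
Proof.
split=> [|a] //=; exists (ncons false a) => /=.
by rewrite -prop_compA swp_wnul nul_nat.
Qed.

Lemma linear_del k : linear (del k).
Proof.
split=> [|a] /=; first by rewrite (precomp (del_nul _)) prop_comp1l.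
exists (fun i => a i.+1).
by rewrite (precomp (del_nat _)) -prop_compA del_add.
Qed.

Lemma linear_sliced n m (f : hom P n m) : sliced phi f -> linear f.
Proof.
elim=> {n m f}.
- exact: linear_id.
- by move=> n m p g f _ hg _ hf; apply: linear_comp.
- by move=> n m f _; apply: linear_whisk.
- exact: linear_swp.
- move=> n m [] k; [exact: linear_mul | exact: linear_nul
                     | exact: linear_dup | exact: linear_del].
Qed.

(** f replaces every column a by some a' on its way to [zero]. *)
Lemma linear_mat n m p (f : hom P m p) r :
  linear f -> exists r', f ∘ mat n m r = mat n p r'.
Proof.
move=> lf; have [f0 fa] := lf.
elim: n r => [|n IH] r /=; first by exists (fun _ _ => false).
have [a ea] := fa (r 0); have [r' er] := IH (fun i => r i.+1).
exists (fun i => if i is j.+1 then r' j else a) => /=.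
by rewrite prop_compA ea -prop_compA -whiskC er.
Qed.

Lemma columnF m : column m (fun=> false) = del m.
Proof. by elim: m => //= m ->; rewrite swp_del. Qed.

(** By induction, id_(1+n) adds the first input to the first output only and
    applies id_n followed by the unit to the others, which is a matrix diagram
    since the unit is linear. *)
Lemma mat_idm n : exists r, idm n = mat n n r.
Proof.
elim: n => [|n [r er]]; first by exists (fun _ _ => false).
have [r' er'] := linear_mat n r (linear_nul n).
rewrite -er prop_comp1r in er'.
exists (fun i => if i is j.+1 then r' j else ncons true (fun=> false)) => /=.
rewrite columnF -er' ctlT -!prop_compA (precomp (esym (swp_del n))).
by rewrite (precomp (del_nat (mul n))) -prop_compA
  (precomp (dup_dell _)) prop_comp1l mul0r.
Qed.

Lemma mat_sliced n m (f : hom P n m) :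
  sliced phi f -> exists r, f = mat n m r.
Proof.
move=> /linear_sliced lf; have [r er] := mat_idm n.
by have [r' e] := linear_mat n r lf; exists r'; rewrite -e -er prop_comp1r.
Qed.

End Bimonoid.

(** * Morphisms of props preserve matrix diagrams *)

Section Functoriality.

Context (P Q : PROP) (phi : forall n m, sbb_gen n m -> hom P n m)
  (psi : forall n m, sbb_gen n m -> hom Q n m) (F : prop_hom P Q).
Context (F_gen : forall n m (s : sbb_gen n m), F n m (phi s) = psi s).

Lemma hom_map_whisk n m (f : hom P n m) : F _ _ (whisk f) = whisk (F _ _ f).
Proof. by have := hom_mapT F (idm 1 : hom P 1 1) f; rewrite hom_mapI. Qed.

Lemma hom_map_pad k n m (f : hom P n m) :
  F _ _ (f ⊕ idm k) = F _ _ f ⊕ idm k.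
Proof. by rewrite hom_mapT hom_mapI. Qed.

Lemma hom_map_zero m : F _ _ (zero phi m) = zero psi m.
Proof.
elim: m => [|m IH] /=; first exact: hom_mapI.
by rewrite hom_mapC IH [X in X ∘ _](hom_map_pad m (phi sbb_eta)) F_gen.
Qed.

Lemma hom_map_add b k : F _ _ (add phi b k) = add psi b k.
Proof.
have Fswp : F _ _ (swp P k) = swp Q k.
  by rewrite [LHS](hom_map_pad k (braid 1 1)) (hom_mapB F 1 1).
case: b => //=; rewrite hom_mapC Fswp; congr (_ ∘ _).
rewrite [LHS](hom_map_pad k (ctl2 phi true)) /ctl hom_mapC hom_map_whisk F_gen.
by rewrite (hom_map_pad 1 (phi sbb_delta)) F_gen.
Qed.

Lemma hom_map_column m a : F _ _ (column phi m a) = column psi m a.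
Proof.
elim: m a => [|m IH] a /=; first by rewrite [LHS](hom_map_pad 0 (phi sbb_epsilon)) F_gen.
by rewrite hom_mapC hom_map_add hom_map_whisk IH.
Qed.

Lemma hom_map_mat n m r : F _ _ (mat phi n m r) = mat psi n m r.
Proof.
elim: n r => [|n IH] r /=; first exact: hom_map_zero.
by rewrite hom_mapC hom_map_column hom_map_whisk IH.
Qed.

End Functoriality.

(** * The model in relations *)

(** [add] as a term, so that its relation can be computed. *)
Definition add_term (b : bool) : term sbb_gen 2 2 :=
  if b then
    TComp TBraid
      (TComp (TSum TId (TGen sbb_mu) : term sbb_gen 3 2)
             (TSum (TGen sbb_delta) TId : term sbb_gen 2 3))
  else TBraid.

Lemma add_teval (P : PROP) (phi : forall n m, sbb_gen n m -> hom P n m) b k :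
  add phi b k = teval phi (add_term b) ⊕ idm k.
Proof. by case: b => //=; rewrite padC. Qed.

Section RelModel.

Definition rel_gen n m (s : sbb_gen n m) : hom Rel n m := [set: 'I_n * 'I_m].

Lemma nrel_gen n m (s : sbb_gen n m) a b :
  nrel (rel_gen s) a b <-> (a < n) && (b < m).
Proof.
split; first by case/nrel_lt => -> ->.
by case/andP=> ha hb; exists (Ordinal ha, Ordinal hb); rewrite ?inE.
Qed.

(** The relation denoted by a term as a boolean function that computes, unlike
    a finite set; the equations of the theory become decidable by evaluation. *)
Fixpoint eval n m (t : term sbb_gen n m) (a b : nat) : bool :=
  match t with
  | TEmpty => false
  | TId => (a == 0) && (b == 0)
  | TBraid => (a == 0) && (b == 1) || (a == 1) && (b == 0)
  | TGen n m s => (a < n) && (b < m)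
  | TComp n m p g f => has (fun c => eval f a c && eval g c b) (iota 0 m)
  | TSum n m p q f g =>
      eval f a b || [&& n <= a, m <= b & eval g (a - n) (b - m)]
  end.

Lemma evalP n m (t : term sbb_gen n m) a b :
  nrel (teval rel_gen t) a b <-> eval t a b.
Proof.
elim: t a b => {n m} /= [a b|a b|a b|n m s a b|n m p g hg f hf a b|n m p q f hf g hg a b].
- by split=> // /nrel_lt[].
- rewrite nrel_idm; split=> [[<-]|/andP[/eqP -> /eqP ->]] //.
  by rewrite ltnS leqn0 => ->.
- rewrite (nrel_braid 1 1); split=> [[]|/orP[]].
  + by rewrite ltnS leqn0 => -[/eqP -> ->].
  + by rewrite ltnS leqn0 => -[/eqP -> ->].
  + by move=> /andP[/eqP -> /eqP ->]; left.
  + by move=> /andP[/eqP -> /eqP ->]; right.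
- exact: nrel_gen.
- rewrite nrel_comp; split=> [[c [h1 h2]]|/hasP[c _ /andP[/hf h1 /hg h2]]].
    apply/hasP; exists c; first by rewrite mem_iota; case: (nrel_lt h1).
    by apply/andP; split; [apply/hf | apply/hg].
  by exists c.
- rewrite nrel_tens; split=> [[/hf -> //|[a' [b' [-> -> /hg h]]]]|].
    by rewrite !leq_addr !addKn h orbT.
  case/orP=> [/hf h|/and3P[ha hb /hg h]]; first by left.
  by right; exists (a - n), (b - m); rewrite !subnKC.
Qed.

Lemma eval_eq n m (s t : term sbb_gen n m) :
  all (fun a => all (fun b => eval s a b == eval t a b) (iota 0 m)) (iota 0 n) ->
  teval rel_gen s = teval rel_gen t.
Proof.
move=> /allP h; apply: nrel_inj => a b.
suff e : a < n -> b < m -> eval s a b = eval t a b.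
  by split=> hab; have [ha hb] := nrel_lt hab; apply/evalP;
    [rewrite -e | rewrite e] => //; apply/evalP.
move=> ha hb; apply/eqP; have := h a; rewrite mem_iota => /(_ ha)/allP; apply.
by rewrite mem_iota.
Qed.

Lemma rel_gen_law n m (s t : term sbb_gen n m) :
  sbb_eqn s t -> teval rel_gen s = teval rel_gen t.
Proof. by case=> {n m s t}; apply: eval_eq. Qed.

Lemma nrel_whisk n m (f : hom Rel n m) a b :
  nrel (whisk f) a b <->
  match a, b with 0, 0 => True | a'.+1, b'.+1 => nrel f a' b' | _, _ => False end.
Proof.
rewrite (nrel_tens (idm 1) f) nrel_idm; split=> [|].
  by case=> [[<-]|[a' [b' [-> -> h]]]] //; case: a.
case: a b => [|a] [|b] // h; first by left.
by right; exists a, b.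
Qed.

Lemma nrel_add b k i j :
  nrel (add rel_gen b k) i j <->
  match i, j with
  | 0, 0 => b : Prop | 0, 1 | 1, 0 => True
  | i'.+2, j'.+2 => i' = j' /\ i' < k
  | _, _ => False end.
Proof.
rewrite add_teval (nrel_tens (teval rel_gen (add_term b)) (idm k)) evalP; split.
  case=> [|[i' [j' [-> -> /nrel_idm[<- hi]]]]] //.
  move=> h; have [hi hj] := nrel_lt (proj2 (evalP (add_term b) i j) h).
  case: i j hi hj h => [|[|i]] [|[|j]] // _ _; by case: (b).
case: i j => [|[|i]] [|[|j]] //.
- by move=> hb; left; rewrite hb.
- by left; case: (b).
- by left; case: (b).
- by case=> <- hi; right; exists i, i; split=> //; apply/nrel_idm.
Qed.

Lemma nrel_column m a i j :
  nrel (column rel_gen m a) i j <->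
  j < m /\ (if i is i'.+1 then i' = j else a j).
Proof.
elim: m a i j => [|m IH] a i j; first by split=> [/nrel_lt[]|[]].
rewrite nrel_comp; split.
  move=> [[|c] [/nrel_add hi /nrel_whisk]]; case: j => [|j] //.
    by case: i hi => [|[|i]].
  move=> /IH[hj hc]; case: c hc hi => [|c] hc.
    by case: i => [|[|i]].
  by case: i => [|[|i]] //= [-> _]; rewrite hc.
move=> [hj hi]; case: j hj hi => [|j] hj.
  case: i => [|i] hi; last rewrite hi;
    by exists 0; split; [apply/nrel_add | apply/nrel_whisk].
case: i => [|i] hi.
  by exists 1; split; [apply/nrel_add | apply/nrel_whisk/IH].
by rewrite hi; exists j.+2; split; [apply/nrel_add | apply/nrel_whisk/IH].
Qed.

Lemma nrel_mat n m r i j :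
  nrel (mat rel_gen n m r) i j <-> [/\ i < n, j < m & r i j].
Proof.
elim: n r i j => [|n IH] r i j; first by split=> [/nrel_lt[]|[]].
rewrite nrel_comp; split.
  move=> [c [/nrel_whisk h /nrel_column[-> hc]]].
  by case: i c h hc => [|i] [|c] // /IH[hi _ hr] e; split; rewrite // -e.
case: i => [|i] [hi hj hr].
  by exists 0; split; [apply/nrel_whisk | apply/nrel_column].
by exists j.+1; split; [apply/nrel_whisk/IH | apply/nrel_column].
Qed.

End RelModel.

(** * The universal property of a presented prop *)

Section CompHom.

Context (P Q R : PROP) (G : prop_hom Q R) (F : prop_hom P Q).

Lemma comp_homI n : G n n (F n n (idm n)) = idm n.
Proof. by rewrite !hom_mapI. Qed.

Lemma comp_homC n m p (g : hom P m p) (f : hom P n m) :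
  G _ _ (F _ _ (g ∘ f)) = G _ _ (F _ _ g) ∘ G _ _ (F _ _ f).
Proof. by rewrite !hom_mapC. Qed.

Lemma comp_homT n m p q (f : hom P n m) (g : hom P p q) :
  G _ _ (F _ _ (f ⊕ g)) = G _ _ (F _ _ f) ⊕ G _ _ (F _ _ g).
Proof. by rewrite !hom_mapT. Qed.

Lemma comp_homB n m : G _ _ (F _ _ (braid n m)) = braid n m.
Proof. by rewrite !hom_mapB. Qed.

Definition comp_hom : prop_hom P R :=
  @PropHom P R (fun n m f => G n m (F n m f))
    comp_homI comp_homC comp_homT comp_homB.

End CompHom.

Section Presentation.

Context (T : theory).

Definition theory_gen n m (s : generators T n m) : hom (theory_prop T) n m :=
  coeq_pi (theory_lhs T) (theory_rhs T) n m (free_class (TGen s)).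

Lemma teval_theory n m (t : term T n m) :
  teval theory_gen t =
  coeq_pi (theory_lhs T) (theory_rhs T) n m (free_class t).
Proof.
rewrite -free_extE; apply: esym.
by apply: (proj2 (free_universal theory_gen) (coeq_pi _ _)).
Qed.

Lemma teval_theory_surj n m (x : hom (theory_prop T) n m) :
  exists t, x = teval theory_gen t.
Proof.
case: (qclass_surj x) => y ->; case: (qclass_surj y) => t ->.
by exists t; rewrite teval_theory.
Qed.

Lemma theory_lhsE n m (e : eqn_sig T n m) :
  theory_lhs T _ _ (free_class (TGen e)) = free_class (sval e).1.
Proof. exact: free_extE. Qed.

Lemma theory_rhsE n m (e : eqn_sig T n m) :
  theory_rhs T _ _ (free_class (TGen e)) = free_class (sval e).2.
Proof. exact: free_extE. Qed.

Lemma theory_gen_law n m (s t : term T n m) :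
  equations s t -> teval theory_gen s = teval theory_gen t.
Proof.
move=> e; pose a : eqn_sig T n m := exist _ (s, t) e.
have := proj1 (coeq_universal (theory_lhs T) (theory_rhs T)) n m
  (free_class (TGen a)).
by rewrite theory_lhsE theory_rhsE !teval_theory.
Qed.

(** The coequalizer property asks for equal values on all of the free prop on
    the equations; a morphism from a free prop being determined by the
    generators, it is enough to have them on the equations themselves. *)
Lemma theory_lift (P : PROP) (phi : forall n m, generators T n m -> hom P n m) :
  (forall n m (s t : term T n m), equations s t -> teval phi s = teval phi t) ->
  exists F : prop_hom (theory_prop T) P,
    forall n m (s : generators T n m), F n m (theory_gen s) = phi n m s.
Proof.
move=> phi_law.
have [|[F FE] _] := proj2 (coeq_universal (theory_lhs T) (theory_rhs T)) P
  (free_ext phi); last first.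
  by exists F => n m s; rewrite [LHS]FE free_extE.
pose psi n m (e : eqn_sig T n m) := teval phi (sval e).1.
move=> n m a; transitivity (free_ext psi n m a).
  apply: (proj2 (free_universal psi)
    (comp_hom (free_ext phi) (theory_lhs T))) => n1 m1 e.
  rewrite -[LHS]/(free_ext phi _ _ (theory_lhs T _ _ (free_class (TGen e)))).
  by rewrite theory_lhsE free_extE.
apply/esym; apply: (proj2 (free_universal psi)
  (comp_hom (free_ext phi) (theory_rhs T))) => n1 m1 e.
rewrite -[LHS]/(free_ext phi _ _ (theory_rhs T _ _ (free_class (TGen e)))).
rewrite theory_rhsE free_extE.
by case: e => [[s t] e]; apply/esym/phi_law.
Qed.

End Presentation.

(** * The isomorphism *)

(** Applying the injective F reduces each law of a morphism for the inverse G
    to the corresponding law of F. *)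
Lemma prop_iso_bij (P Q : PROP) (F : prop_hom P Q)
    (G : forall n m, hom Q n m -> hom P n m) :
  (forall n m (f g : hom P n m), F n m f = F n m g -> f = g) ->
  (forall n m (g : hom Q n m), F n m (G n m g) = g) ->
  prop_iso Q P.
Proof.
move=> F_inj FG.
have GI n : G n n (idm n) = idm n by apply: F_inj; rewrite FG hom_mapI.
have GC n m p (g : hom Q m p) (f : hom Q n m) :
    G n p (g ∘ f) = G m p g ∘ G n m f.
  by apply: F_inj; rewrite hom_mapC !FG.
have GT n m p q (f : hom Q n m) (g : hom Q p q) :
    G _ _ (f ⊕ g) = G _ _ f ⊕ G _ _ g.
  by apply: F_inj; rewrite hom_mapT !FG.
have GB n m : G _ _ (braid n m) = braid n m.
  by apply: F_inj; rewrite FG hom_mapB.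
exists (PropHom GI GC GT GB), F; split=> //= n m f.
by apply: F_inj; rewrite FG.
Qed.

Theorem theorem7p2 : prop_iso Rel (theory_prop special_bicommutative_bimonoids).
Proof.
pose T := special_bicommutative_bimonoids.
pose phi : forall n m, sbb_gen n m -> hom (theory_prop T) n m :=
  @theory_gen T.
have [F FE] := @theory_lift T Rel rel_gen rel_gen_law.
have FM n m r : F n m (mat phi n m r) = mat rel_gen n m r.
  by apply: hom_map_mat.
have phi_mat n m (f : hom (theory_prop T) n m) : exists r, f = mat phi n m r.
  have [t ->] := teval_theory_surj f.
  apply: (@mat_sliced (theory_prop T) phi); last exact: sliced_teval.
  by move=> *; apply: theory_gen_law.
apply: (@prop_iso_bij _ _ F (fun n m (R : hom Rel n m) =>
  mat phi n m (fun i j => `[< nrel R i j >]))) => [n m f g|n m R].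
  have [[r ->] [s ->]] := (phi_mat _ _ f, phi_mat _ _ g).
  rewrite !FM => e; apply: eq_mat => i j hi hj.
  have nE t : nrel (mat rel_gen n m t) i j <-> t i j.
    by rewrite nrel_mat; split=> [[]|].
  by apply/idP/idP => /nE; [rewrite e | rewrite -e] => /nE.
rewrite FM; apply: nrel_inj => i j; rewrite nrel_mat.
split=> [[_ _ /asboolP]|h] //.
by have [] := nrel_lt h; split=> //; apply/asboolP.
Qed.
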